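(* For arbitrary real $\alpha>0$ and $\beta>0$ and every integer $N\geqslant1$, $$\sum_{k=1}^{N}(-1)^{k}\alpha^{2k}\beta^{2N+2-2k}\,\zeta^{2}(2k)\,\zeta^{2}(2N+2-2k)=-\left(\beta^{2}\right)^{N+1}\sum_{m=1}^{\infty}\sum_{n=1}^{\infty}\frac{\tau_{0}(n)\,\tau_{0}(m)}{m^{2N}}\,\frac{\alpha^{2}}{\beta^{2}n^{2}+\alpha^{2}m^{2}}-\left(-\alpha^{2}\right)^{N+1}\sum_{m=1}^{\infty}\sum_{n=1}^{\infty}\frac{\tau_{0}(n)\,\tau_{0}(m)}{n^{2N}}\,\frac{\beta^{2}}{\alpha^{2}m^{2}+\beta^{2}n^{2}}.$$
   Context: $\zeta$ is the Riemann zeta function, $\zeta^2(s)=(\zeta(s))^2$, and $\tau_0(n)$ is the number of positive divisors of $n$. *)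

(* Defs.v *)
From mathcomp Require Import all_boot all_order all_algebra.
From mathcomp Require Import all_classical all_reals all_analysis.
Set Implicit Arguments.
Unset Strict Implicit.
Unset Printing Implicit Defensive.
Import Order.TTheory GRing.Theory Num.Theory.
Import numFieldNormedType.Exports.
Local Open Scope ring_scope.

(* The Riemann zeta function at a real argument s > 1, where it is given by
   its Dirichlet series; [riemannR s n] is 1 / (n + 1)^s. The value is not
   meaningful for s <= 1, where this series diverges. *)
Definition zeta (R : realType) (s : R) : R :=
  limn (series (riemannR s)).

Definition tau0 (n : nat) : nat := size (divisors n).

(* Main.v *)
(* Grouping the double series of zeta(s)^2 by the value of the product of the
   two indices gives zeta(s)^2 = \sum_n tau0(n) / n^s. With a = alpha^2,
   b = beta^2, x = a / n^2 and y = b / m^2, the left-hand side is therefore the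
   sum over m and n of tau0(m) tau0(n) times the finite geometric sum
   \sum_(1 <= k <= N) (- x)^k y^(N + 1 - k), whose closed form
   - y^(N + 1) x / (x + y) - (- x)^(N + 1) y / (x + y) gives the terms of the
   two double series on the right. These series have nonnegative terms and are
   dominated by products of convergent simple series, so the linear relation
   between terms survives summation over n and then over m. *)
Require Import Defs.
From mathcomp Require Import all_boot all_order all_algebra.
From mathcomp Require Import all_classical all_reals all_analysis.
From mathcomp Require Import ring lra.
Set Implicit Arguments.
Unset Strict Implicit.
Unset Printing Implicit Defensive.
Import Order.TTheory GRing.Theory Num.Theory.
Import numFieldNormedType.Exports.
Local Open Scope ring_scope.

(** * Zeta values as series in the extended reals *)

(* At n = 0 the right-hand side is 2, since 0^-1 = 0. *)
Lemma sum_invsqr_le (R : realType) (n : nat) :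
  \sum_(0 <= i < n) (i.+1%:R ^+ 2)^-1 <= 2 - n%:R^-1 :> R.
Proof.
elim: n => [|[|n] IHn]; first by rewrite big_geq // invr0; lra.
  by rewrite big_nat1 expr1n; lra.
rewrite big_nat_recr //=; apply: (le_trans (lerD IHn (lexx _))).
rewrite -subr_ge0.
have n1 : (0 : R) < n.+1%:R by [].
have -> : n.+2%:R = n.+1%:R + 1 :> R by rewrite -natr1.
move: n1; move: (n.+1%:R : R) => x x0.
have -> : 2 - (x + 1)^-1 - (2 - x^-1 + ((x + 1) ^+ 2)^-1) =
    (x * (x + 1) ^+ 2)^-1.
  by field; apply/andP; split; lra.
by rewrite invr_ge0 mulr_ge0 ?sqr_ge0 // ltW.
Qed.

(** Comparison with the exponent 2 bounds the partial sums by 2, so the real limit defining [zeta]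
    exists and agrees with the extended-real sum. The shift by 1 matches [riemannR], whose term of
    index n is 1 / (n + 1)^s. *)
Lemma eseries_zeta (R : realType) (s : nat) : (2 <= s)%N ->
  (\sum_(1 <= n <oo) ((n%:R ^+ s)^-1)%:E = (zeta (s%:R : R))%:E)%E.
Proof.
move=> s2.
rewrite -(@nneseries_addn _ (fun n => ((n%:R ^+ s)^-1)%:E) 1%N); last first.
  by move=> i; rewrite lee_fin invr_ge0 exprn_ge0.
have rE i : riemannR (s%:R : R) i = (i.+1%:R ^+ s)^-1.
  by rewrite /riemannR powR_mulrn.
have cv : cvgn (series (riemannR (s%:R : R))).
  apply: nondecreasing_is_cvgn.
    by apply: nondecreasing_series => i _ _; rewrite rE invr_ge0 exprn_ge0.
  exists 2 => _ [n _ <-].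
  apply: (@le_trans _ _ (\sum_(0 <= i < n) (i.+1%:R ^+ 2)^-1)).
    apply: ler_sum => i _; rewrite rE lef_pV2 ?posrE ?exprn_gt0 //.
    by rewrite ler_weXn2l // ler1n.
  by apply: (le_trans (sum_invsqr_le _ _)); rewrite gerBl invr_ge0.
rewrite /zeta -EFin_lim //; congr (limn _); apply/funext => n /=.
rewrite /series /= -sumEFin; apply: eq_bigr => i _.
by rewrite addn1 -rE.
Qed.

Lemma tau0E (n : nat) : (0 < n)%N ->
  tau0 n = (\sum_(1 <= d < n.+1 | (d %| n)%N) 1)%N.
Proof.
move=> n0; rewrite sum1_count /tau0 -size_filter; apply/perm_size.
apply: uniq_perm; rewrite ?divisors_uniq ?filter_uniq ?iota_uniq // => d.
rewrite -dvdn_divisors // mem_filter mem_index_iota ltnS.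
case dn: (d %| n)%N => //=.
by rewrite (dvdn_gt0 n0 dn) (dvdn_leq n0 dn).
Qed.

Local Open Scope ereal_scope.

(** Both sides sum f n over the pairs (d, n) with d dividing n; nonnegativity allows the order of
    summation to be exchanged. *)
Lemma eseries_divisors (R : realType) (f : nat -> R) :
  (forall n, (0 <= f n)%R) ->
  \sum_(1 <= d <oo) \sum_(1 <= j <oo) (f (d * j)%N)%:E =
  \sum_(1 <= n <oo) ((tau0 n)%:R * f n)%:E.
Proof.
move=> f0.
pose g d n := if (d %| n)%N then (f n)%:E else 0.
have g0 d n : 0 <= g d n by rewrite /g; case: ifP; rewrite ?lee_fin.
transitivity (\sum_(1 <= d <oo) \sum_(1 <= n <oo) g d n).
  rewrite !(ereal_series _ 1); apply: eq_eseriesr => d d0.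
  rewrite !(ereal_series _ 1) -eseries_mkcondr.
  rewrite !nneseries_esum => [|n _|n _]; rewrite ?lee_fin //.
  (* For fixed d > 0, j |-> d * j is a bijection from the positive integers onto the positive
     multiples of d. *)
  apply/esym/(@reindex_esum _ _ _ _ _ (fun j => (d * j)%N)); split.
  - by move=> j /= j0; rewrite muln_gt0 d0 j0 dvdn_mulr.
  - move=> i j _ _ /= /eqP; rewrite eqn_pmul2l //; exact/eqP.
  - move=> n /= /andP[n0 /dvdnP[j nE]]; exists j; last by rewrite mulnC -nE.
    by move: n0; rewrite nE muln_gt0 => /andP[].
rewrite !(ereal_series _ 1).
transitivity (\sum_(n <oo | (1 <= n)%N) \sum_(d <oo | (1 <= d)%N) g d n).
  rewrite -nneseries_interchange //.
  by apply: eq_eseriesr => d _; rewrite ereal_series.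
apply: eq_eseriesr => n n0.
(* Divisors of n are at most n, so the sum over d vanishes beyond n. *)
rewrite -ereal_series (@nneseries_split _ _ 1 n) // [X in _ + X]eseries0 ?adde0.
  rewrite add1n -big_mkcond /= tau0E // natr_sum mulr_suml sumEFin.
  by congr (_%:E); apply: eq_bigr => d _; rewrite mul1r.
by move=> d; rewrite add1n => nd _; rewrite /g gtnNdvd.
Qed.

(** Since n^(-s) is completely multiplicative, the double sum over d and j factors. *)
Lemma eseries_tau0 (R : realType) (s : nat) : (2 <= s)%N ->
  \sum_(1 <= n <oo) ((tau0 n)%:R * (n%:R ^+ s)^-1)%:E
  = (zeta (s%:R : R) ^+ 2)%:E.
Proof.
move=> s2.
have f0 n : (0 <= (n%:R ^+ s)^-1 :> R)%R by rewrite invr_ge0 exprn_ge0.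
rewrite -eseries_divisors // !(ereal_series _ 1).
under eq_eseriesr => d _.
  under eq_eseriesr => j _ do rewrite natrM exprMn invfM EFinM.
  rewrite nneseriesZl; last by move=> j _; rewrite lee_fin.
  rewrite eseries_zeta // muleC; over.
rewrite -ereal_series nneseriesZl; last by move=> j _; rewrite lee_fin.
by rewrite eseries_zeta // expr2 EFinM.
Qed.

(** * Summation of linear relations and domination of double series *)

(** The coefficients may have any sign, so the relation is summed on real partial sums and passed to
    the limit, where uniqueness of limits concludes. *)
Lemma eseries_linear (R : realType) (r : seq nat) (u : nat -> nat -> R)
    (c U : nat -> R) (t1 t2 : nat -> R) (d1 d2 T1 T2 : R) :
  (forall k n, 0 <= u k n)%R -> (forall n, 0 <= t1 n)%R ->
  (forall n, 0 <= t2 n)%R ->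
  {in r, forall k, \sum_(1 <= n <oo) (u k n)%:E = (U k)%:E} ->
  \sum_(1 <= n <oo) (t1 n)%:E = T1%:E ->
  \sum_(1 <= n <oo) (t2 n)%:E = T2%:E ->
  (forall n, (0 < n)%N ->
     (\sum_(k <- r) c k * u k n = d1 * t1 n + d2 * t2 n)%R) ->
  (\sum_(k <- r) c k * U k = d1 * T1 + d2 * T2)%R.
Proof.
have cvS (f : nat -> R) (F : R) : (forall n, 0 <= f n)%R ->
    \sum_(1 <= n <oo) (f n)%:E = F%:E ->
    ((\sum_(1 <= n < m) f n)%R @[m --> \oo] --> F)%classic.
  move=> f0 fF.
  have H : (\sum_(1 <= n < m) (f n)%:E @[m --> \oo] --> F%:E)%classic.
    by rewrite -fF; apply: is_cvg_nneseries => n _ _; rewrite lee_fin.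
  by move: H => /fine_cvg; under eq_fun do rewrite /= sumEFin /=.
move=> u0 t10 t20 uU tT1 tT2 rel.
have L : ((\sum_(k <- r) c k * \sum_(1 <= n < m) u k n)%R @[m --> \oo]
          --> (\sum_(k <- r) c k * U k)%R)%classic.
  under eq_fun do rewrite big_seq; rewrite big_seq.
  apply: cvg_big => [|k kr]; first exact: add_continuous.
  by apply: cvgMl_tmp; apply: cvS => //; exact: uU.
have H := cvgD (cvgMl_tmp (a := d1) (cvS _ _ t10 tT1))
  (cvgMl_tmp (a := d2) (cvS _ _ t20 tT2)).
apply: (norm_cvg_unique L) => /=.
suff -> : (fun m => \sum_(k <- r) c k * \sum_(1 <= n < m) u k n)%R =
  (fun m => d1 * \sum_(1 <= n < m) t1 n + d2 * \sum_(1 <= n < m) t2 n)%R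
  by exact: H.
apply/funext => m /=; rewrite !mulr_sumr -big_split /=.
under eq_bigr do rewrite mulr_sumr.
rewrite exchange_big /=; apply: eq_big_nat => n /andP[n0 _].
by rewrite rel.
Qed.

(** Domination by a product bounds row m by p m * Q and the total by P * Q. The row sums are thus
    real, which is the form [eseries_linear] requires for a second summation. *)
Lemma iterated_eseries_fin (R : realType) (g : nat -> nat -> R)
    (p q : nat -> R) (P Q : R) :
  (forall m n, 0 <= g m n)%R -> (forall m, 0 <= p m)%R ->
  (forall n, 0 <= q n)%R ->
  (forall m n, (0 < m)%N -> (0 < n)%N -> g m n <= p m * q n)%R ->
  \sum_(1 <= m <oo) (p m)%:E = P%:E -> \sum_(1 <= n <oo) (q n)%:E = Q%:E ->
  exists (t : nat -> R) (T : R), [/\ (forall m, 0 <= t m)%R,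
    (forall m, (0 < m)%N -> \sum_(1 <= n <oo) (g m n)%:E = (t m)%:E),
    \sum_(1 <= m <oo) (t m)%:E = T%:E &
    \sum_(1 <= m <oo) \sum_(1 <= n <oo) (g m n)%:E = T%:E].
Proof.
move=> g0 p0 q0 gpq pP qQ.
pose s m := \sum_(1 <= n <oo) (g m n)%:E.
have s0 m : 0 <= s m by apply: nneseries_ge0 => n _ _; rewrite lee_fin.
have sp m : (0 < m)%N -> s m <= (p m * Q)%:E.
  move=> m0; rewrite EFinM -qQ -nneseriesZl;
    last by move=> n _; rewrite lee_fin.
  rewrite /s !(ereal_series _ 1); apply: lee_nneseries => n.
    by rewrite lee_fin.
  by move=> n0; rewrite -EFinM lee_fin gpq.
have Q0 : (0 <= Q)%R.
  by rewrite -lee_fin -qQ; apply: nneseries_ge0 => n _ _; rewrite lee_fin.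
have sE m : (0 < m)%N -> s m = (fine (s m))%:E.
  by move=> m0; rewrite fineK // ge0_fin_numE // (le_lt_trans (sp m m0)) ?ltry.
have t0 m : (0 <= fine (s m))%R by exact: fine_ge0.
have tS : \sum_(1 <= m <oo) (fine (s m))%:E = \sum_(1 <= m <oo) s m.
  by rewrite !(ereal_series _ 1); apply: eq_eseriesr => m m0; rewrite -sE.
have SE : \sum_(1 <= m <oo) s m = (fine (\sum_(1 <= m <oo) s m))%:E.
  rewrite fineK // ge0_fin_numE; last by apply: nneseries_ge0 => m _ _.
  apply: (@le_lt_trans _ _ (Q * P)%:E); last exact: ltry.
  rewrite EFinM -pP -nneseriesZl; last by move=> m _; rewrite lee_fin.
  rewrite !(ereal_series _ 1); apply: lee_nneseries => m // m0.
  by rewrite -EFinM mulrC sp.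
by exists (fun m => fine (s m)), (fine (\sum_(1 <= m <oo) s m));
  split => //; rewrite tS.
Qed.

Local Close Scope ereal_scope.

(** * The finite geometric sum behind each term *)

Lemma alternating_geometric (F : fieldType) (x y : F) (N : nat) : x + y != 0 ->
  \sum_(1 <= k < N.+1) (- x) ^+ k * y ^+ (N.+1 - k) =
  - (y ^+ N.+1 * (x / (x + y))) - (- x) ^+ N.+1 * (y / (x + y)).
Proof.
move=> xy; elim: N => [|N IHN]; first by rewrite big_geq // !expr1; field.
rewrite big_nat_recr //= subSnn expr1.
have -> : \sum_(1 <= k < N.+1) (- x) ^+ k * y ^+ (N.+2 - k) =
          y * \sum_(1 <= k < N.+1) (- x) ^+ k * y ^+ (N.+1 - k).
  rewrite mulr_sumr; apply: eq_big_nat => k /andP[_ kN].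
  by rewrite subSn ?exprS; [ring | exact: ltnW].
by rewrite IHN !exprS; field.
Qed.

(* The k-th term is (- x) ^+ k * y ^+ (N.+1 - k) with x = a / n ^+ 2 and
   y = b / m ^+ 2. *)
Lemma term_identity (R : realFieldType) (a b m n : R) (N : nat) :
  0 < a -> 0 < b -> 0 < m -> 0 < n ->
  \sum_(1 <= k < N.+1) (-1) ^+ k *
     (a ^+ k * b ^+ (N.+1 - k) *
      (m ^+ (2 * (N.+1 - k)))^-1 * (n ^+ (2 * k))^-1) =
  - b ^+ N.+1 * ((m ^+ (2 * N))^-1 * (a / (b * n ^+ 2 + a * m ^+ 2))) +
  - (- a) ^+ N.+1 * ((n ^+ (2 * N))^-1 * (b / (a * m ^+ 2 + b * n ^+ 2))).
Proof.
move=> a0 b0 m0 n0.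
have m2 : 0 < m ^+ 2 by rewrite exprn_gt0.
have n2 : 0 < n ^+ 2 by rewrite exprn_gt0.
have x0 : 0 < a / n ^+ 2 by rewrite divr_gt0.
have y0 : 0 < b / m ^+ 2 by rewrite divr_gt0.
under eq_bigr => k _.
  have -> : (-1) ^+ k *
     (a ^+ k * b ^+ (N.+1 - k) * (m ^+ (2 * (N.+1 - k)))^-1 * (n ^+ (2 * k))^-1)
     = (- (a / n ^+ 2)) ^+ k * (b / m ^+ 2) ^+ (N.+1 - k).
    rewrite (exprNn (a / _)) !exprMn !exprVn -!exprM; ring.
  over.
rewrite alternating_geometric; last by rewrite gt_eqF // addr_gt0.
rewrite (exprNn (a / _)) (exprNn a) !exprMn !exprVn -!exprM.
(* Splitting the exponent 2 * (N + 1) as 2 + 2 * N lets the four powers of m and n become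
   independent nonzero variables, leaving an identity for [field]. *)
rewrite !(mulnS 2 N) !(exprD _ 2 (2 * N)).
have : m ^+ (2 * N) != 0 by rewrite expf_neq0 // gt_eqF.
have : n ^+ (2 * N) != 0 by rewrite expf_neq0 // gt_eqF.
clear x0 y0; move: m2 n2.
move: (m ^+ (2 * N)) (n ^+ (2 * N)) (m ^+ 2) (n ^+ 2) => M K p q p0 q0 K0 M0.
have apbq : a * p + b * q != 0 by rewrite gt_eqF // addr_gt0 // mulr_gt0.
by field; rewrite apbq K0 M0 !gt_eqF.
Qed.

(** * Summation over both indices *)

Lemma zeta_sqr_convolution (R : realType) (a b : R) (N : nat) :
  0 < a -> 0 < b -> (1 <= N)%N ->
  ((\sum_(1 <= k < N.+1) (-1) ^+ k * a ^+ k * b ^+ (N.+1 - k)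
      * zeta ((2 * k)%:R : R) ^+ 2 * zeta ((2 * (N.+1 - k))%:R : R) ^+ 2)%:E =
   - (b ^+ N.+1)%:E *
       (\sum_(1 <= m <oo) \sum_(1 <= n <oo)
          ((tau0 n)%:R * (tau0 m)%:R / m%:R ^+ (2 * N) *
           (a / (b * n%:R ^+ 2 + a * m%:R ^+ 2)))%:E)
   - ((- a) ^+ N.+1)%:E *
       (\sum_(1 <= m <oo) \sum_(1 <= n <oo)
          ((tau0 n)%:R * (tau0 m)%:R / n%:R ^+ (2 * N) *
           (b / (a * m%:R ^+ 2 + b * n%:R ^+ 2)))%:E))%E.
Proof.
move=> a0 b0 hN.
pose w s n : R := (tau0 n)%:R * (n%:R ^+ s)^-1.
have w0 s n : 0 <= w s n by rewrite mulr_ge0 ?invr_ge0 ?exprn_ge0.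
have wE s : (2 <= s)%N ->
    (\sum_(1 <= n <oo) (w s n)%:E = (zeta (s%:R : R) ^+ 2)%:E)%E.
  exact: eseries_tau0.
have N2 : (2 <= 2 * N)%N by rewrite leq_pmulr.
pose g1 m n : R := (tau0 n)%:R * (tau0 m)%:R / m%:R ^+ (2 * N) *
  (a / (b * n%:R ^+ 2 + a * m%:R ^+ 2)).
pose g2 m n : R := (tau0 n)%:R * (tau0 m)%:R / n%:R ^+ (2 * N) *
  (b / (a * m%:R ^+ 2 + b * n%:R ^+ 2)).
have a0' := ltW a0; have b0' := ltW b0.
have g10 m n : 0 <= g1 m n.
  by rewrite !mulr_ge0 ?invr_ge0 ?addr_ge0 ?mulr_ge0 ?exprn_ge0.
have g20 m n : 0 <= g2 m n.
  by rewrite !mulr_ge0 ?invr_ge0 ?addr_ge0 ?mulr_ge0 ?exprn_ge0.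
(* Dropping one positive summand of the denominator separates the variables: the bounds have
   exponents 2 * N and 2, both at least 2 because N >= 1. *)
have frac_le (x y z : R) : 0 < x -> 0 < y -> 0 <= z -> z / (x + y) <= z / x.
  move=> x0 y0 z0; rewrite ler_wpM2l // lef_pV2 ?posrE ?addr_gt0 //.
  by rewrite lerDl ltW.
have g1w m n : (0 < m)%N -> (0 < n)%N ->
    g1 m n <= w (2 * N)%N m * (a / b * w 2 n).
  move=> m0 n0; apply: (@le_trans _ _
    ((tau0 n)%:R * (tau0 m)%:R / m%:R ^+ (2 * N) *
    (a / (b * n%:R ^+ 2)))).
    rewrite ler_wpM2l ?mulr_ge0 ?invr_ge0 ?exprn_ge0 //.
    by rewrite frac_le // mulr_gt0 // exprn_gt0 // ltr0n.
  by rewrite /w invfM le_eqVlt; apply/orP; left; apply/eqP; ring.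
have g2w m n : (0 < m)%N -> (0 < n)%N ->
    g2 m n <= (b / a * w 2 m) * w (2 * N)%N n.
  move=> m0 n0; apply: (@le_trans _ _
    ((tau0 n)%:R * (tau0 m)%:R / n%:R ^+ (2 * N) *
    (b / (a * m%:R ^+ 2)))).
    rewrite ler_wpM2l ?mulr_ge0 ?invr_ge0 ?exprn_ge0 //.
    by rewrite frac_le // mulr_gt0 // exprn_gt0 // ltr0n.
  by rewrite /w invfM le_eqVlt; apply/orP; left; apply/eqP; ring.
have wcE c s : 0 <= c -> (2 <= s)%N ->
    (\sum_(1 <= n <oo) (c * w s n)%:E = (c * zeta (s%:R : R) ^+ 2)%:E)%E.
  move=> c0 s2; under eq_eseriesr do rewrite EFinM.
  by rewrite nneseriesZl ?wE // => n _; rewrite lee_fin.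
have ab0 : 0 <= a / b by rewrite divr_ge0.
have ba0 : 0 <= b / a by rewrite divr_ge0.
have [|t1 [T1 [t10 g1t t1T g1T]]] := iterated_eseries_fin g10 (w0 _) _ g1w
  (wE _ N2) (wcE _ _ ab0 (leqnn 2)).
  by move=> n; rewrite mulr_ge0.
have [|t2 [T2 [t20 g2t t2T g2T]]] := iterated_eseries_fin g20 _ (w0 _) g2w
  (wcE _ _ ba0 (leqnn 2)) (wE _ N2).
  by move=> n; rewrite mulr_ge0.
rewrite g1T g2T -!EFinN -!EFinM -EFinB; congr (_%:E).
pose C k := a ^+ k * b ^+ (N.+1 - k).
have C0 k : 0 <= C k by rewrite mulr_ge0 ?exprn_ge0.
pose z s := zeta (s%:R : R) ^+ 2.
have z0 s : 0 <= z s by rewrite sqr_ge0.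
(* Outer summation, over m: the sum over n has already turned [w (2 * k) n] into [z (2 * k)]. *)
have := @eseries_linear R (index_iota 1 N.+1)
  (fun k m => C k * z (2 * k)%N * w (2 * (N.+1 - k))%N m)
  (fun k => (-1) ^+ k) (fun k => C k * z (2 * k)%N * z (2 * (N.+1 - k))%N)
  t1 t2 (- b ^+ N.+1) (- (- a) ^+ N.+1) T1 T2.
rewrite -mulNr => <- //.
- apply: eq_big_nat => k /andP[k0 kN].
  by rewrite /C /z; ring.
- by move=> k n; apply: mulr_ge0 => //; apply: mulr_ge0.
- move=> k; rewrite mem_index_iota => /andP[k0 kN]; apply: wcE.
    by rewrite mulr_ge0.
  by rewrite leq_pmulr // subn_gt0.
move=> m m0.
(* Inner summation, over n with m fixed: the factor in m is a constant, and [t1 m], [t2 m] are the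
   row sums of [g1], [g2]. *)
apply: (@eseries_linear R _
  (fun k n => C k * w (2 * (N.+1 - k))%N m * w (2 * k)%N n) _ _
  (g1 m) (g2 m)) => //.
- by move=> k n; apply: mulr_ge0 => //; apply: mulr_ge0.
- move=> k; rewrite mem_index_iota => /andP[k0 kN].
  have Cw : 0 <= C k * w (2 * (N.+1 - k))%N m by exact: mulr_ge0.
  have k2 : (2 <= 2 * k)%N by rewrite leq_pmulr.
  by rewrite (wcE _ _ Cw k2) mulrAC.
- by rewrite -g1t.
- by rewrite -g2t.
move=> n n0.
have := @term_identity R a b m%:R n%:R N a0 b0.
rewrite !ltr0n => /(_ m0 n0) E.
(* The relation between terms is [term_identity] multiplied by tau0(n) tau0(m). *)
transitivity ((tau0 n)%:R * (tau0 m)%:R *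
  \sum_(1 <= k < N.+1) (-1) ^+ k *
     (C k * (m%:R ^+ (2 * (N.+1 - k)))^-1 * (n%:R ^+ (2 * k))^-1)).
  by rewrite mulr_sumr; apply: eq_bigr => k _; rewrite /w; ring.
by rewrite E /g1 /g2; ring.
Qed.

(* The infinite sums have nonnegative terms and are taken in \bar R. As the
   left-hand side is a real number, the equality also says that both double
   series converge. *)
Theorem mainTheorem3 (R : realType) (alpha beta : R)
    (halpha : 0 < alpha) (hbeta : 0 < beta) (N : nat) (hN : (1 <= N)%N) :
  ((\sum_(1 <= k < N.+1)
      (-1) ^+ k * alpha ^+ (2 * k) * beta ^+ (2 * N + 2 - 2 * k)
      * zeta ((2 * k)%:R : R) ^+ 2
      * zeta ((2 * N + 2 - 2 * k)%:R : R) ^+ 2)%:E =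
   - ((beta ^+ 2) ^+ N.+1)%:E *
       (\sum_(1 <= m <oo) \sum_(1 <= n <oo)
          ((tau0 n)%:R * (tau0 m)%:R / m%:R ^+ (2 * N) *
           (alpha ^+ 2 /
              (beta ^+ 2 * n%:R ^+ 2 + alpha ^+ 2 * m%:R ^+ 2)))%:E)
   - ((- alpha ^+ 2) ^+ N.+1)%:E *
       (\sum_(1 <= m <oo) \sum_(1 <= n <oo)
          ((tau0 n)%:R * (tau0 m)%:R / n%:R ^+ (2 * N) *
           (beta ^+ 2 /
              (alpha ^+ 2 * m%:R ^+ 2 + beta ^+ 2 * n%:R ^+ 2)))%:E))%E.

Proof.
rewrite -zeta_sqr_convolution ?exprn_gt0 //; congr (_%:E).
apply: eq_big_nat => k _.
by rewrite -!exprM mulnBr mulnS (addnC 2).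
Qed.
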